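(* Let $n\ge1$ and let $m_1,m_2,\dots,m_n$ be natural numbers. Let $f$ be a function on $\mathbb{R}^n$ such that for every $i=1,\dots,n$ the distributional derivative $D_i^{m_i} f$ is a (complex-valued, not necessarily positive) Borel measure. Let $\mu$ be the vector-valued measure $\mu=(D_1^{m_1} f, D_2^{m_2} f,\dots,D_n^{m_n} f)$. Then $\dim\mu\ge n-1$.
   Context: $D_i$ denotes the (distributional) derivative with respect to the coordinate $x_i$. For a vector-valued complex Borel measure $\mu$ on $\mathbb{R}^n$, its lower Hausdorff dimension is $\dim\mu=\inf\{\alpha : \text{there is a Borel set } F \text{ with } \mu(F)\neq 0 \text{ and } \dim F\le\alpha\}$, where $\dim F$ is the Hausdorff dimension of $F$. *)

(* Defs.v *)
From HB Require Import structures.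
From mathcomp Require Import all_boot all_order all_algebra.
From mathcomp Require Import all_classical all_reals all_analysis.

Set Implicit Arguments.
Unset Strict Implicit.
Unset Printing Implicit Defensive.

Import Order.TTheory GRing.Theory Num.Theory.
Import numFieldNormedType.Exports.

Local Open Scope classical_set_scope.
Local Open Scope ring_scope.

Section Defs.
Variable R : realType.

Definition Rn (n : nat) := 'rV[R]_n.

Definition BRn (n : nat) := g_sigma_algebraType (@open (Rn n)).

Definition evec (n : nat) (i : 'I_n) : Rn n := delta_mx 0 i.

Definition partial (n : nat) (i : 'I_n) (g : Rn n -> R) : Rn n -> R :=
  fun x => derive g x (evec i).

Fixpoint iter_partial (n : nat) (s : seq 'I_n) (g : Rn n -> R) : Rn n -> R :=
  match s with
  | [::] => g
  | i :: s' => partial i (iter_partial s' g)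
  end.

Definition smooth (n : nat) (g : Rn n -> R) : Prop :=
  forall s : seq 'I_n,
    continuous (iter_partial s g) /\
    forall (i : 'I_n) (x : Rn n), derivable (iter_partial s g) x (evec i).

Definition test_function (n : nat) (g : Rn n -> R) : Prop :=
  smooth g /\ compact (closure [set x | g x != 0]).

(* The Lebesgue measure on R^n: the measure on Borel sets that gives to
   every closed box its Euclidean volume (it exists and is unique). *)
Definition is_lebesgue (n : nat) (L : {measure set (BRn n) -> \bar R}) : Prop :=
  forall a b : Rn n, (forall i, a 0 i <= b 0 i) ->
    L [set x : BRn n | forall i, a 0 i <= x 0 i <= b 0 i] =
    (\prod_(i < n) (b 0 i - a 0 i))%:E.

Definition loc_integrable (n : nat) (L : {measure set (BRn n) -> \bar R})
  (g : BRn n -> R) : Prop :=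
  measurable_fun setT g /\
  forall K : set (Rn n), compact K -> L.-integrable K (fun x => (g x)%:E).

(* [signed_integral nu phi v]: v = \int phi d nu for a real (finite) signed
   Borel measure nu, computed through any decomposition nu = P - N into two
   finite positive measures (the value does not depend on the decomposition). *)
Definition signed_integral (n : nat) (nu : {charge set (BRn n) -> \bar R})
  (phi : BRn n -> R) (v : R) : Prop :=
  exists P N : {finite_measure set (BRn n) -> \bar R},
    (forall A, measurable A -> nu A = (P A - N A)%E) /\
    ((\int[P]_x (phi x)%:E) - (\int[N]_x (phi x)%:E))%E = v%:E.

(* The distributional derivative D_i^m of the complex function f = fr + i fi
   is the complex Borel measure lambda = lr + i li: for every test function
   phi,  <D_i^m f, phi> = (-1)^m \int f D_i^m phi dx = \int phi d lambda
   (real and imaginary parts; real test functions suffice by linearity). *)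
Definition distr_deriv_is_measure (n : nat) (L : {measure set (BRn n) -> \bar R})
  (fr fi : BRn n -> R) (i : 'I_n) (m : nat)
  (lr li : {charge set (BRn n) -> \bar R}) : Prop :=
  forall phi : Rn n -> R, test_function phi ->
    signed_integral lr phi
      (fine (\int[L]_x ((fr x * ((-1) ^+ m * iter_partial (nseq m i) phi x))%:E)))
    /\
    signed_integral li phi
      (fine (\int[L]_x ((fi x * ((-1) ^+ m * iter_partial (nseq m i) phi x))%:E))).

Definition edist (n : nat) (x y : Rn n) : R :=
  Num.sqrt (\sum_(i < n) (x 0 i - y 0 i) ^+ 2).

(* diameter of a set (in the extended reals; -oo for the empty set) *)
Definition diam (n : nat) (U : set (Rn n)) : \bar R :=
  ereal_sup [set (edist x y)%:E | x in U & y in U].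

Definition diam_pow (n : nat) (s : R) (U : set (Rn n)) : \bar R :=
  if pselect (U !=set0) then (powR (fine (diam U)) s)%:E else 0%E.

Definition hausdorff_delta (n : nat) (s delta : R) (F : set (Rn n)) : \bar R :=
  ereal_inf [set (\sum_(k <oo) diam_pow s (U k))%E |
             U in [set U : nat -> set (Rn n) |
                   F `<=` \bigcup_k U k /\ forall k, (diam (U k) <= delta%:E)%E]].

Definition hausdorff_measure (n : nat) (s : R) (F : set (Rn n)) : \bar R :=
  ereal_sup [set hausdorff_delta s delta F | delta in [set d : R | 0 < d]].

Definition hausdorff_dim (n : nat) (F : set (Rn n)) : \bar R :=
  ereal_inf [set s%:E | s in [set s : R | 0 <= s /\ hausdorff_measure s F = 0%E]].

(* lower Hausdorff dimension of the vector-valued complex measure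
   mu = (lr k + i li k)_{k < n}:
   inf { alpha : exists Borel F, mu(F) <> 0 and dim F <= alpha } *)
Definition vmeasure_dim (n : nat) (lr li : 'I_n -> {charge set (BRn n) -> \bar R})
  : \bar R :=
  ereal_inf [set alpha%:E | alpha in
    [set alpha : R | exists F : set (BRn n), measurable F /\
        (exists k, lr k F != 0%E \/ li k F != 0%E) /\
        (hausdorff_dim (F : set (Rn n)) <= alpha%:E)%E]].

End Defs.

(* Main.v *)
(* For each i the function f and the measure nu = D_i^m f satisfy, for every
   cylinder C = {x : x' in E} over a set E of the coordinates other than i and
   every u in C_c^infty(R),
     int_C u(x_i) dnu = (-1)^m int_C f u^(m)(x_i) dx:
   test with products u(x_i) prod_{j <> i} v_j(x_j) and let the v_j tend to
   indicators of intervals.  If C is Lebesgue null, the right-hand side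
   vanishes, also for every smaller cylinder, so nu vanishes on all Borel
   subsets of C.  A set F with H^s(F) = 0 for some s < n - 1 projects to a
   Lebesgue null set of R^(n-1), hence lies in such a null cylinder. *)
Require Import Defs.
From HB Require Import structures.
From mathcomp Require Import all_boot all_order all_algebra.
From mathcomp Require Import all_classical all_reals all_analysis.
From mathcomp Require Import measurable_realfun ring lra.

Set Implicit Arguments.
Unset Strict Implicit.
Unset Printing Implicit Defensive.

Import Order.TTheory GRing.Theory Num.Theory.
Import numFieldNormedType.Exports.

Local Open Scope classical_set_scope.
Local Open Scope ring_scope.

(** * Flat functions and smooth bumps on the line *)

Section FlatFunction.
Variable R : realType.
Implicit Types (f g v : R -> R) (a b c t : R).

(** The order of the two approximations matters. No derivative falls on the factors v_j, so they
    tend to indicators under a majorant independent of the step. The factor u carries all m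
    derivatives, and u^(m) may blow up when u tends to the indicator of an interval; this is
    harmless, because u is varied only after the right-hand side has become exactly 0 over the null
    cylinder. The limit in u is also what reaches subsets: for a signed nu = P - N, the equality
    nu(C) = 0 says nothing about parts of C, whereas P = N on the traces on C of all boxes
    determines both restrictions to C. Since f is only locally integrable, the right-hand side is a
    charge in E only over cylinders with bounded base; this is why all identities are localized to
    [ocyl]. Each component of the vector measure is treated alone, with its own direction i and its
    own null cylinder. *)

Definition smooth1 f : Prop := forall k t, derivable (derive1n k f) t 1.

(* The family [t^-k e^(-1/t)] is closed under differentiation up to linear
   combinations, and contains the standard flat function (k = 0). *)
Definition flat_exp k t : R := if 0 < t then t^-1 ^+ k * expR (- t^-1) else 0.

Lemma flat_exp_ge0 k t : 0 <= flat_exp k t.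
Proof.
rewrite /flat_exp; case: ifP => // t0.
by rewrite mulr_ge0 ?expR_ge0 // exprn_ge0 // invr_ge0 ltW.
Qed.

(** With s = 1/t this follows from e^s >= s^(k+1)/(k+1)!. The bound is linear in t so that it
    controls difference quotients at the origin. *)
Lemma flat_exp_le k t : flat_exp k t <= k.+1`!%:R * `|t|.
Proof.
rewrite /flat_exp; case: ifP => t0; last by rewrite mulr_ge0.
have s0 : 0 <= t^-1 by rewrite invr_ge0 ltW.
rewrite expRN ler_pdivrMr ?expR_gt0 // gtr0_norm //.
have := expR_ge1Dxn k s0; set e := expR _ => he.
have e1 : t^-1 ^+ k.+1 / k.+1`!%:R <= e.
  by apply: le_trans he; rewrite lerDr.
have F0 : 0 < k.+1`!%:R :> R by rewrite ltr0n fact_gt0.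
rewrite ler_pdivrMr // in e1.
have -> : t^-1 ^+ k = t * t^-1 ^+ k.+1 by rewrite exprS mulrA divff ?mul1r ?gt_eqF.
rewrite [leRHS](_ : _ = t * (e * k.+1`!%:R)); last by ring.
by rewrite ler_pM2l.
Qed.

Lemma is_derive_flat_exp k t :
  is_derive t 1 (flat_exp k) (flat_exp k.+2 t - k%:R * flat_exp k.+1 t).
Proof.
case: (ltgtP 0 t) => t0.
- pose g := fun x : R => x^-1 ^+ k * expR (- x^-1).
  apply: (@near_eq_is_derive _ _ _ g).
    near=> x; rewrite /flat_exp /g ifT //.
    by near: x; exact: lt_nbhsr.
  have tn0 : t != 0 by rewrite gt_eqF.
  have dV : is_derive t 1 (fun x : R => x^-1) (- t ^- 2).
    apply: is_derive_eq; first exact: is_deriveV.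
    by rewrite scaler1.
  have dE : is_derive t 1 (fun x : R => expR (- x^-1)) (expR (- t^-1) * t ^- 2).
    have dN : is_derive t 1 (fun x : R => - x^-1) (t ^- 2).
      by rewrite -[X in is_derive _ _ _ X]opprK; exact: (is_deriveN dV).
    exact: (@is_derive1_comp _ expR (fun x => - x^-1) _ _ _ (is_derive_expR _) dN).
  have dX j : is_derive t 1 (fun x : R => x^-1 ^+ j) (- j%:R * t^-1 ^+ j.+1).
    elim: j => [|j IH].
      rewrite oppr0 mul0r; under eq_fun do rewrite expr0.
      exact: is_derive_cst.
    under eq_fun do rewrite exprS.
    apply: (is_derive_eq (is_deriveM dV IH)).
    rewrite /GRing.scale /= -!exprVn !exprS -[j.+1]addn1 natrD; ring.
  apply: (is_derive_eq (is_deriveM (dX k) dE)).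
  rewrite /flat_exp t0 /GRing.scale /=.
  by rewrite -!exprVn !exprS; ring.
- apply: (@near_eq_is_derive _ _ _ (cst 0)).
    near=> x; rewrite /flat_exp /= ifF //.
    by apply/negbTE; rewrite -leNgt ltW //; near: x; exact: lt_nbhsl.
  rewrite /flat_exp ifF ?ifF; [|by rewrite lt_gtF..].
  by rewrite mulr0 subr0; exact: is_derive_cst.
- rewrite -t0 /flat_exp ltxx mulr0 subr0 -/(flat_exp k).
  have cv : h^-1 *: (flat_exp k (h *: 1 + 0) - flat_exp k 0) @[h --> 0^'] --> (0 : R).
    apply/cvgr0Pnorm_le => e e0.
    near=> h.
    have h0 : h != 0 by near: h; exact: nbhs_dnbhs_neq.
    rewrite /GRing.scale /= mulr1 addr0 {2}/flat_exp ltxx subr0.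
    have [hp|hn] := ltP 0 h; last by rewrite /flat_exp ltNge hn /= mulr0 normr0 ltW.
    (* Dividing by h raises the index by one, and the linear bound at index k+1 makes the quotient
       tend to 0. *)
    have -> : h^-1 * flat_exp k h = flat_exp k.+1 h.
      by rewrite /flat_exp hp exprS mulrA.
    rewrite ger0_norm ?flat_exp_ge0 //.
    apply: le_trans (flat_exp_le _ _) _.
    rewrite mulrC -ler_pdivlMr ?ltr0n ?fact_gt0 //.
    near: h; apply: dnbhs0_le.
    by rewrite divr_gt0 // ltr0n fact_gt0.
  apply: DeriveDef; first by apply/cvg_ex; exists 0.
  exact: cvg_lim.
Unshelve. all: by end_near. Qed.

(** Smoothness of finite order allows induction: the derivative of a product is a sum of products of
    functions that are smooth to one order less. *)
Definition smooth_upto N f : Prop := forall k, (k < N)%N -> forall t, derivable (derive1n k f) t 1.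

Lemma smooth_uptoS N f :
  smooth_upto N.+1 f <-> (forall t, derivable f t 1) /\ smooth_upto N (derive1 f).
Proof.
split=> [h|[h0 h] [|k] kN t]; last 2 first.
- exact: h0.
- by rewrite derive1Sn; exact: h.
by split=> [t|k kN t]; [exact: (h 0%N)|rewrite -derive1Sn; exact: h].
Qed.

Lemma smooth_upto0 f : smooth_upto 0 f. Proof. by []. Qed.

Lemma smooth_uptoW N f : smooth_upto N.+1 f -> smooth_upto N f.
Proof. by move=> h k kN; apply: h; rewrite ltnW. Qed.

Lemma smooth_upto_is_derive N f g : (forall t, is_derive t 1 f (g t)) ->
  smooth_upto N g -> smooth_upto N.+1 f.
Proof.
move=> fg gN; apply/smooth_uptoS; split=> [t|]; first by have := fg t; case.
suff -> : (derive1 f) = g by [].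
by apply/funext => t; rewrite derive1E; apply: derive_val.
Qed.

Lemma smooth_uptoD N f g : smooth_upto N f -> smooth_upto N g ->
  smooth_upto N (f \+ g).
Proof.
elim: N f g => [*|N IH]; first exact: smooth_upto0.
move=> f g /smooth_uptoS[df sf] /smooth_uptoS[dg sg].
apply: (@smooth_upto_is_derive _ _ ((derive1 f) \+ (derive1 g))); last exact: (IH _ _ sf sg).
by move=> t; rewrite /= !derive1E; apply: is_deriveD; apply: derivableP.
Qed.

Lemma smooth_uptoM N f g : smooth_upto N f -> smooth_upto N g ->
  smooth_upto N (f \* g).
Proof.
elim: N f g => [*|N IH]; first exact: smooth_upto0.
move=> f g sf sg.
have /smooth_uptoS[df sf'] := sf; have /smooth_uptoS[dg sg'] := sg.
apply: (@smooth_upto_is_derive _ _ ((f \* (derive1 g)) \+ (g \* (derive1 f)))).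
  by move=> t; rewrite /= !derive1E; apply: is_deriveM; apply: derivableP.
by apply: smooth_uptoD; [exact: IH (smooth_uptoW sf) sg'|exact: IH (smooth_uptoW sg) sf'].
Qed.

Lemma smooth_upto_cst N c : smooth_upto N (fun=> c).
Proof.
elim: N c => [*|N IH]; first exact: smooth_upto0.
move=> c.
by apply: smooth_upto_is_derive (IH 0) => t; exact: is_derive_cst.
Qed.

Lemma smooth_upto_affine N f a b : smooth_upto N f ->
  smooth_upto N (fun t => f (a * t + b)).
Proof.
elim: N f => [*|N IH]; first exact: smooth_upto0.
move=> f /smooth_uptoS[df sf].
apply: (@smooth_upto_is_derive _ _ ((fun t => (derive1 f) (a * t + b)) \* (fun=> a))).
  move=> t; rewrite /= derive1E.
  apply: (@is_derive1_comp _ f (fun t => a * t + b)); first exact: derivableP.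
  have dm : is_derive t 1 (fun t : R => a * t) a.
    apply: (is_derive_eq (is_deriveM (is_derive_cst a t 1) (is_derive_id t 1))).
    by rewrite /GRing.scale /= mulr1 mulr0 addr0.
  by apply: (is_derive_eq (is_deriveD dm (is_derive_cst b t 1))); rewrite addr0.
by apply: smooth_uptoM; [exact: (IH _ sf)|exact: smooth_upto_cst].
Qed.

Lemma smooth_upto_flat_exp N k : smooth_upto N (flat_exp k).
Proof.
elim: N k => [*|N IH]; first exact: smooth_upto0.
move=> k.
apply: smooth_upto_is_derive (is_derive_flat_exp k) _.
rewrite (_ : (fun _ => _) =
  (flat_exp k.+2 \+ ((fun=> - k%:R) \* flat_exp k.+1))).
  apply: smooth_uptoD; first exact: IH.
  by apply: smooth_uptoM; [exact: smooth_upto_cst|exact: IH].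
by apply/funext => t /=; rewrite mulNr.
Qed.

(** On (a, b) this is exp(-1/((r+1)(t-a)) - 1/((r+1)(b-t))), and it is 0 elsewhere. The factor r+1
    sends the exponent to 0, so the limit is the indicator of the open interval. The arguments are
    spelled as affine maps to fit [smooth_upto_affine]. *)
Definition bump a b (r : nat) t : R :=
  flat_exp 0 (r.+1%:R * t + - (r.+1%:R * a)) *
  flat_exp 0 (- r.+1%:R * t + r.+1%:R * b).

Lemma bumpE a b r t :
  bump a b r t = flat_exp 0 (r.+1%:R * (t - a)) * flat_exp 0 (r.+1%:R * (b - t)).
Proof. by rewrite /bump; congr (flat_exp _ _ * flat_exp _ _); ring. Qed.

Lemma bump_smooth a b r : smooth1 (bump a b r).
Proof.
move=> k; apply: (_ : smooth_upto k.+1 (bump a b r)) => //.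
by apply: smooth_uptoM; apply: smooth_upto_affine; exact: smooth_upto_flat_exp.
Qed.

Lemma flat_exp0_le1 t : flat_exp 0 t <= 1.
Proof.
rewrite /flat_exp; case: ifP => // t0.
by rewrite mul1r -expR0 ler_expR oppr_le0 invr_ge0 ltW.
Qed.

Lemma bump_ge0 a b r t : 0 <= bump a b r t.
Proof. by rewrite mulr_ge0 // flat_exp_ge0. Qed.

Lemma bump_le1 a b r t : bump a b r t <= 1.
Proof. by rewrite mulr_ile1 // ?flat_exp_ge0 ?flat_exp0_le1. Qed.

Lemma bump_out a b r t : ~~ (a < t < b) -> bump a b r t = 0.
Proof.
rewrite negb_and -!leNgt bumpE /flat_exp.
rewrite !pmulr_rgt0 // !subr_gt0.
by case/orP => h; [rewrite (ltNge a) h mul0r|rewrite (ltNge t b) h mulr0].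
Qed.

Lemma bump_cvg a b t :
  bump a b r t @[r --> \oo] --> if a < t < b then 1 else 0 : R.
Proof.
case: ifPn => [/andP[at_ tb]|h]; last first.
  by under eq_cvg do rewrite bump_out //; exact: cvg_cst.
have fl (d : R) : 0 < d -> flat_exp 0 (r.+1%:R * d) @[r --> \oo] --> (1 : R).
  move=> d0.
  have -> : (fun r => flat_exp 0 (r.+1%:R * d)) = (fun r : nat => expR (- (d^-1 * r.+1%:R^-1))).
    by apply/funext => r; rewrite /flat_exp pmulr_rgt0 // d0 mul1r invfM mulrC.
  rewrite -[X in _ --> X]expR0 -oppr0 -[X in - X](mulr0 d^-1).
  apply: continuous_cvg; first exact: continuous_expR.
  apply: cvgN; apply: cvgM; first exact: cvg_cst.
  exact: cvg_harmonic.
rewrite -[X in _ --> X]mulr1.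
under eq_cvg do rewrite bumpE.
by apply: cvgM; apply: fl; rewrite subr_gt0.
Qed.

(** The conclusion is about the complement of the closed interval because that set is open: near
    each of its points the function is constantly 0, and the induction on k can go on. *)
Lemma derive1n_out a b v : (forall t, ~~ (a < t < b) -> v t = 0) ->
  forall k t, ~~ (a <= t <= b) -> (derive1n k v) t = 0.
Proof.
move=> v0; elim=> [|k IH] t ht.
  by apply: v0; apply: contra ht => /andP[/ltW-> /ltW->].
rewrite derive1nS derive1E (@near_eq_derive _ _ _ _ (cst 0)) ?derive_cst //.
move: ht; rewrite negb_and -!ltNge => /orP[h|h].
  near=> s; apply: IH; rewrite negb_and -ltNge; apply/orP; left.
  by near: s; exact: lt_nbhsl.
near=> s; apply: IH; rewrite negb_and -!ltNge; apply/orP; right.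
by near: s; exact: lt_nbhsr.
Unshelve. all: by end_near. Qed.

Lemma smooth1_continuous v k : smooth1 v -> continuous (derive1n k v).
Proof.
by move=> sv t; apply: differentiable_continuous; apply/derivable1_diffP; exact: sv.
Qed.

Lemma bump_continuous a b r : continuous (bump a b r).
Proof.
move=> t; apply: differentiable_continuous; apply/derivable1_diffP.
exact: (@bump_smooth a b r 0%N).
Qed.

Lemma derive1n_bounded a b v k : smooth1 v ->
  (forall t, ~~ (a < t < b) -> v t = 0) ->
  exists2 M, 0 <= M & forall t, `|derive1n k v t| <= M.
Proof.
move=> sv v0; have out := @derive1n_out a b v v0 k.
have [ab|ba] := leP a b; last first.
  exists 0 => // t; rewrite out ?normr0 //; apply/negP => /andP[h1 h2].
  by have := le_lt_trans (le_trans h1 h2) ba; rewrite ltxx.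
have [c _ hc] : exists2 c, c \in `[a, b] &
    forall t, t \in `[a, b] -> `|derive1n k v t| <= `|derive1n k v c|.
  apply: (@EVT_max _ (fun t => `|derive1n k v t|)) => //.
  apply: continuous_subspaceT => t.
  by apply: cvg_norm; exact: smooth1_continuous.
exists `|derive1n k v c| => // t.
have [tab|tab] := boolP (t \in `[a, b]); first exact: hc.
by rewrite out ?normr0 //; rewrite in_itv /= in tab.
Qed.

End FlatFunction.

(** * Open boxes as generators of the Borel sets, and cylinders *)

Section BorelBoxes.
Variables (R : realType) (n : nat).
Implicit Types (a b x : Rn R n) (i j : 'I_n).

Definition obox a b : set (Rn R n) := [set x | forall j, a 0 j < x 0 j < b 0 j].

Lemma open_ord_forall (A : 'I_n -> set (Rn R n)) :
  (forall j, open (A j)) -> open [set x | forall j, A j x].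
Proof.
move=> oA; rewrite openE => x Ax.
suff : \forall y \near x, forall j, A j y by [].
by apply: (@filter_forall _ _ A (nbhs x) _) => j; apply: open_nbhs_nbhs; split.
Qed.

Lemma measurable_ord_forall (A : 'I_n -> set (BRn R n)) :
  (forall j, measurable (A j)) -> measurable [set x | forall j, A j x].
Proof.
move=> mA; rewrite (_ : [set _ | _] = \bigcap_(j in setT) A j).
  by apply: fin_bigcap_measurable => //; exact: finite_finset.
by apply/seteqP; split=> x /= Ax j; [move=> _|]; exact: Ax.
Qed.

Lemma continuous_measurable_Rn (f : Rn R n -> R) :
  continuous f -> measurable_fun setT (f : BRn R n -> R).
Proof.
move=> cf; apply: (measurability _ (measurable_realfun.RGenOInfty.measurableE R)).
move=> _ [_ [x ->] <-]; rewrite setTI; apply: sub_sigma_algebra.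
by move/continuousP : cf; apply; exact: interval_open.
Qed.

Lemma measurable_coord j : measurable_fun setT (fun x : BRn R n => x 0 j).
Proof. by apply: continuous_measurable_Rn; exact: coord_continuous. Qed.

Lemma open_obox a b : open (obox a b).
Proof.
apply: open_ord_forall => j.
rewrite (_ : (fun _ => _) = (fun x : Rn R n => x 0 j) @^-1` `]a 0 j, b 0 j[%classic).
  by move/continuousP: (@coord_continuous R 1 n 0 j); apply; exact: interval_open.
by apply/seteqP; split=> x /=; rewrite in_itv.
Qed.

Lemma obox_rat_nbhs x (O : set (Rn R n)) : open O -> O x ->
  exists ab : 'rV[rat]_n * 'rV[rat]_n,
    obox (map_mx ratr ab.1) (map_mx ratr ab.2) `<=` O /\
    obox (map_mx ratr ab.1) (map_mx ratr ab.2) x.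
Proof.
move=> oO Ox; have /nbhs_ballP[e /= e0 eO] := open_nbhs_nbhs (conj oO Ox).
have /choice[p hp] : forall j, exists p : rat * rat,
    (x 0 j - e < ratr p.1 < x 0 j) && (x 0 j < ratr p.2 < x 0 j + e).
  move=> j.
  have /rat_in_itvoo[q1 q1x] : x 0 j - e < x 0 j by rewrite ltrBlDr ltrDl.
  have /rat_in_itvoo[q2 q2x] : x 0 j < x 0 j + e by rewrite ltrDl.
  by exists (q1, q2); move: q1x q2x; rewrite !in_itv /= => -> ->.
exists (\row_j (p j).1, \row_j (p j).2); split => [y yb|j]; last first.
  by rewrite !mxE; have /andP[/andP[_ ->] /andP[-> _]] := hp j.
apply: eO; split=> // i j; rewrite ord1 -ball_normE /= ltr_distlC.
have := yb j; rewrite !mxE => /andP[y1 y2].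
have /andP[/andP[h1 _] /andP[_ h2]] := hp j.
by apply/andP; split; [exact: lt_trans h1 y1|exact: lt_trans y2 h2].
Qed.

(** An open set is the union of the boxes with rational corners that it contains, and these are
    countably many. *)
Lemma borel_obox :
  @measurable _ (BRn R n) = <<s [set obox ab.1 ab.2 | ab in [set: Rn R n * Rn R n]] >>.
Proof.
apply/seteqP; split; apply: smallest_sub; try exact: smallest_sigma_algebra.
  move=> O oO.
  pose D := [set ab : 'rV[rat]_n * 'rV[rat]_n |
    obox (map_mx ratr ab.1) (map_mx ratr ab.2) `<=` O].
  have -> : O = \bigcup_(ab in D) obox (map_mx ratr ab.1) (map_mx ratr ab.2).
    apply/seteqP; split => [x Ox|x [ab Dab]]; last exact: Dab.
    by have [ab [abO abx]] := obox_rat_nbhs oO Ox; exists ab.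
  pose G := [set obox ab.1 ab.2 | ab in [set: Rn R n * Rn R n]].
  rewrite bigcup_mkcond.
  apply: (@countable_bigcupT_measurable _ (g_sigma_algebraType G)).
    exact: countableP.
  move=> ab; case: ifP => _; last exact: (@measurable0 _ (g_sigma_algebraType G)).
  apply: sub_sigma_algebra.
  by exists (map_mx ratr ab.1, map_mx ratr ab.2).
by move=> _ [ab _ <-]; apply: sub_sigma_algebra; exact: open_obox.
Qed.

Lemma oboxI a b a' b' : obox a b `&` obox a' b' =
  obox (\row_j Num.max (a 0 j) (a' 0 j)) (\row_j Num.min (b 0 j) (b' 0 j)).
Proof.
apply/seteqP; split => x /=.
  move=> [h h'] j; rewrite !mxE gt_max lt_min.
  by have /andP[-> ->] := h j; have /andP[-> ->] := h' j.
move=> h; split=> j; have := h j; rewrite !mxE gt_max lt_min.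
  by move=> /andP[/andP[-> _] /andP[-> _]].
by move=> /andP[/andP[_ ->] /andP[_ ->]].
Qed.

Lemma setI_closed_obox :
  setI_closed [set obox ab.1 ab.2 | ab in [set: Rn R n * Rn R n]].
Proof.
move=> _ _ [ab _ <-] [ab' _ <-]; rewrite oboxI.
by exists (\row_j Num.max (ab.1 0 j) (ab'.1 0 j), \row_j Num.min (ab.2 0 j) (ab'.2 0 j)).
Qed.

Lemma obox_cover : \bigcup_k obox (const_mx (- k%:R)) (const_mx k%:R) = setT.
Proof.
apply/seteqP; split => // x _.
pose M := \sum_j `|x 0 j|.
have [k Mk] : exists k : nat, M < k%:R.
  by eexists; exact: truncnS_gt.
exists k => // j; rewrite !mxE -ltr_norml; apply: le_lt_trans Mk.
by rewrite /M (bigD1 j) //= lerDl sumr_ge0.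
Qed.

Lemma finite_measure_obox_eq (m1 m2 : {measure set (BRn R n) -> \bar R}) :
  (m1 setT < +oo)%E ->
  (forall a b, m1 (obox a b) = m2 (obox a b)) ->
  forall A, measurable A -> m1 A = m2 A.
Proof.
move=> fm1 e; apply: (@measure_unique _ R (BRn R n)
  [set obox ab.1 ab.2 | ab in [set: Rn R n * Rn R n]]
  (fun k : nat => obox (const_mx (- k%:R)) (const_mx k%:R))).
- exact: borel_obox.
- exact: setI_closed_obox.
- by move=> k; exists (const_mx (- k%:R), const_mx k%:R).
- exact: obox_cover.
- by move=> _ [ab _ <-].
- move=> k; apply: le_lt_trans fm1; apply: le_measure; rewrite ?inE //.
  by apply: sub_sigma_algebra; exact: open_obox.
Qed.

Definition cylinder (i : 'I_n) (A : 'I_n -> set R) : set (BRn R n) :=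
  [set x | forall j, j != i -> A j (x 0 j)].

Lemma measurable_cylinder i (A : 'I_n -> set R) :
  (forall j, measurable (A j)) -> measurable (cylinder i A).
Proof.
move=> mA; apply: measurable_ord_forall => j.
have [->|ji] := eqVneq j i.
  by rewrite [X in measurable X](_ : _ = setT) //; exact/seteqP.
rewrite [X in measurable X](_ : _ = setT `&` (fun x : BRn R n => x 0 j) @^-1` A j).
  exact: measurable_coord.
by rewrite setTI; apply/seteqP; split=> x /= h //; exact: h.
Qed.

(* Preimages of boxes under [flatten_coord i] are cylinders, so an identity on
   cylinders extends to cylinders over Borel sets through the boxes of R^n,
   without a separate measurable structure on R^(n-1). *)
Definition flatten_coord i (x : BRn R n) : BRn R n := \row_j (if j == i then 0 else x 0 j).

(** The preimage of a box depends on whether its i-th side contains 0: if so it is a cylinder over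
    the other sides, otherwise it is empty. *)
Lemma measurable_flatten_coord i : measurable_fun setT (flatten_coord i).
Proof.
apply: (measurability _ borel_obox) => _ [_ [ab _ <-] <-]; rewrite setTI.
have [h|h] := boolP (ab.1 0 i < 0 < ab.2 0 i); last first.
  rewrite [X in measurable X](_ : _ = set0) //; apply/seteqP; split=> // x /=.
  by move/(_ i); rewrite mxE eqxx (negbTE h).
rewrite [X in measurable X](_ : _ =
  cylinder i (fun j => `]ab.1 0 j, ab.2 0 j[%classic)).
  exact: measurable_cylinder.
apply/seteqP; split=> x /=.
  by move=> hx j ji; have := hx j; rewrite mxE (negbTE ji) /= in_itv.
move=> hx j; rewrite mxE; case: (eqVneq j i) => [->//|ji].
by have := hx j ji; rewrite /= in_itv.
Qed.

End BorelBoxes.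

(** * Products of one-variable functions as test functions *)

Section TensorTestFunctions.
Variables (R : realType) (n : nat).
Implicit Types (a b x : Rn R n) (i j : 'I_n) (v : 'I_n -> R -> R).

Definition tensor v (x : Rn R n) : R := \prod_j v j (x 0 j).

Lemma cvg_bigprod (T : Type) (F : set_system T) (FF : Filter F)
    (g : 'I_n -> T -> R) (l : 'I_n -> R) (s : seq 'I_n) :
  (forall j, g j t @[t --> F] --> l j) ->
  \prod_(j <- s) g j t @[t --> F] --> \prod_(j <- s) l j.
Proof.
move=> gl; elim: s => [|j s IH].
  by rewrite big_nil; under eq_cvg do rewrite big_nil; exact: cvg_cst.
by rewrite big_cons; under eq_cvg do rewrite big_cons; exact: cvgM.
Qed.

Lemma tensor_continuous v : (forall j, continuous (v j)) -> continuous (tensor v).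
Proof.
move=> cv; suff cvx (x : Rn R n) : tensor v y @[y --> x] --> tensor v x by [].
apply: (@cvg_bigprod _ _ (nbhs_filter x)) => j.
have cx : y 0 j @[y --> x] --> x 0 j by exact: coord_continuous.
exact: (cvg_comp _ _ cx (cv j _)).
Qed.

(** Along [evec R i] only the factor [v i] varies; the product of the others is a constant c. *)
Lemma is_derive_tensor v i x : derivable (v i) (x 0 i) 1 ->
  is_derive x (evec R i) (tensor v)
    (tensor (fun j => if j == i then derive1 (v i) else v j) x).
Proof.
move=> dv.
pose c := \prod_(j | j != i) v j (x 0 j).
have tE h : tensor v (h *: evec R i + x) = v i (h *: 1 + x 0 i) * c.
  rewrite /tensor (bigD1 i) //= !mxE !eqxx /=; congr (_ * _).
  apply: eq_bigr => j ji; rewrite !mxE (negbTE ji) andbF.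
  by rewrite mulr0 add0r.
have tE0 : tensor v x = v i (x 0 i) * c by rewrite /tensor (bigD1 i).
have cv : h^-1 *: (tensor v (h *: evec R i + x) - tensor v x) @[h --> 0^'] -->
    'D_1 (v i) (x 0 i) * c.
  under eq_cvg do rewrite tE tE0 -mulrBl /GRing.scale /= mulrA.
  by apply: cvgM; [exact: dv|exact: cvg_cst].
have -> : tensor (fun j => if j == i then derive1 (v i) else v j) x =
    'D_1 (v i) (x 0 i) * c.
  rewrite /tensor (bigD1 i) //= eqxx derive1E; congr (_ * _).
  by apply: eq_bigr => j /negbTE->.
apply: DeriveDef; last exact: cvg_lim.
by apply/cvg_ex; eexists; exact: cv.
Qed.

Lemma iter_partial_tensor v (s : seq 'I_n) : (forall j, smooth1 (v j)) ->
  iter_partial s (tensor v) = tensor (fun j => derive1n (count_mem j s) (v j)).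
Proof.
move=> sv; elim: s => [//|i s IH] /=; rewrite IH; apply/funext => x.
rewrite /partial; have [_ ->] := @is_derive_tensor
  (fun j => derive1n (count_mem j s) (v j)) i x (sv i _ _).
congr tensor; apply/funext => j; rewrite eq_sym.
by case: eqVneq => [->|ij] //=; rewrite ?add1n ?add0n ?derive1nS.
Qed.

Lemma tensor_smooth v : (forall j, smooth1 (v j)) -> smooth (tensor v).
Proof.
move=> sv s; rewrite iter_partial_tensor //; split=> [|i x].
  by apply: tensor_continuous => j; exact: smooth1_continuous.
by case: (@is_derive_tensor (fun j => derive1n (count_mem j s) (v j)) i x (sv i _ _)).
Qed.

Definition cbox a b : set (Rn R n) := [set x | forall j, a 0 j <= x 0 j <= b 0 j].

Lemma compact_cbox a b : compact (cbox a b).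
Proof.
rewrite (_ : cbox a b = [set v | forall i, `[a 0 i, b 0 i]%classic (v ord0 i)]).
  apply: (@rV_compact R n (fun i => `[a 0 i, b 0 i]%classic)) => i.
  exact: segment_compact.
by apply/seteqP; split=> x /= h i; have := h i; rewrite in_itv.
Qed.

Lemma measurable_cbox a b : measurable (cbox a b : set (BRn R n)).
Proof.
apply: measurable_ord_forall => j.
rewrite [X in measurable X](_ : _ =
  setT `&` (fun x : BRn R n => x 0 j) @^-1` `[a 0 j, b 0 j]%classic).
  exact: measurable_coord.
by rewrite setTI; apply/seteqP; split=> x /=; rewrite in_itv.
Qed.

Lemma tensor_out a b v : (forall j t, ~~ (a 0 j <= t <= b 0 j) -> v j t = 0) ->
  forall x, ~ cbox a b x -> tensor v x = 0.
Proof.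
move=> v0 x /existsNP[j /negP xj].
by rewrite /tensor (bigD1 j) //= v0 // mul0r.
Qed.

Lemma tensor_test_function a b v : (forall j, smooth1 (v j)) ->
  (forall j t, ~~ (a 0 j <= t <= b 0 j) -> v j t = 0) ->
  test_function (tensor v).
Proof.
move=> sv v0; split; first exact: tensor_smooth.
apply: (subclosed_compact (@closed_closure _ _) (@compact_cbox a b)).
have -> : cbox a b = closure (cbox a b).
  apply/closure_id; apply: compact_closed; last exact: compact_cbox.
  exact: norm_hausdorff.
apply: closure_subset => x /= /eqP nz; apply: contrapT => nx.
by apply: nz; exact: (@tensor_out a b).
Qed.

End TensorTestFunctions.

(** * Null cylinders around sets of small Hausdorff dimension *)

Section NullCylinder.
Variables (R : realType) (n : nat).
Implicit Types (c x y : Rn R n) (i j : 'I_n) (d s : R).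

Lemma coord_le_edist x y j : `|x 0 j - y 0 j| <= Defs.edist x y.
Proof.
rewrite -sqrtr_sqr ler_wsqrtr // (bigD1 j) //= lerDl sumr_ge0 // => k _.
exact: sqr_ge0.
Qed.

Definition tube i c d : set (BRn R n) :=
  cylinder i (fun j => `[c 0 j - d, c 0 j + d]%classic).

Lemma measurable_tube i c d : measurable (tube i c d).
Proof. exact: measurable_cylinder. Qed.

Lemma tube_flatten_coord i c d x : tube i c d (flatten_coord i x) <-> tube i c d x.
Proof.
by split=> h j ji; have := h j ji; rewrite mxE (negbTE ji).
Qed.

(* The radius [cd.2] is the diameter of U; for empty U a degenerate tube is used,
   of zero volume because n.-1 > 0. *)
Lemma small_set_in_tube i s (U : set (Rn R n)) : s < n%:R - 1 -> 0 <= s ->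
  (diam U <= 1%:E)%E ->
  exists cd : Rn R n * R, [/\ 0 <= cd.2, U `<=` tube i cd.1 cd.2 &
    (((2 * cd.2) ^+ n.-1)%:E <= (2 ^+ n.-1)%:E * diam_pow s U)%E].
Proof.
move=> sn s0 U1.
have n1 : (0 < n.-1)%N.
  have : 1 < n%:R :> R by lra.
  by rewrite ltr1n; case: n => [|[]].
rewrite /diam_pow; case: pselect => [[u Uu]|U0]; last first.
  exists (0, 0) => /=; split => //; last by rewrite mulr0 expr0n gtn_eqF // mule0.
  by move=> x Ux; exfalso; apply: U0; exists x.
have ub x : U x -> ((Defs.edist x u)%:E <= diam U)%E.
  by move=> Ux; apply: ereal_sup_ubound; exists x => //; exists u.
have d0 : (0 <= diam U)%E.
  apply: le_trans (ub _ Uu); rewrite lee_fin; exact: sqrtr_ge0.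
have dfin : diam U \is a fin_num.
  by rewrite ge0_fin_numE // (le_lt_trans U1) // ltry.
set d := fine (diam U).
have dE : diam U = d%:E by rewrite fineK.
have d0' : 0 <= d by rewrite -lee_fin -dE.
have d1 : d <= 1 by rewrite -lee_fin -dE.
exists (u, d) => /=; split => //.
  move=> x Ux j ji /=; rewrite in_itv /= -ler_distl distrC.
  by rewrite distrC (le_trans (coord_le_edist _ _ _)) // -lee_fin -dE; exact: ub.
(* Here the bound 1 on the diameter is used: d <= 1 and s < n - 1 give d^(n-1) <= d^s. *)
rewrite -EFinM lee_fin exprMn ler_pM2l ?exprn_gt0 //.
have [->|dn0] := eqVneq d 0; first by rewrite expr0n gtn_eqF // powR_ge0.
rewrite -powR_mulrn //; apply: ger_powR; first by rewrite lt_neqAle eq_sym dn0 d0' d1.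
by rewrite -subn1 natrB ?ltW //; case: n n1.
Qed.

Variable L : {measure set (BRn R n) -> \bar R}.
Hypothesis lebL : is_lebesgue L.

(** A tube of positive radius has infinite measure because it is unbounded in direction i;
    intersecting it with a slab leaves a box of known volume. *)
Definition slab i (M : R) : set (BRn R n) := [set x | - M <= x 0 i <= M].

Lemma measurable_slab i M : measurable (slab i M).
Proof.
rewrite [X in measurable X](_ : _ =
  setT `&` (fun x : BRn R n => x 0 i) @^-1` `[- M, M]%classic).
  exact: measurable_coord.
by rewrite setTI; apply/seteqP; split=> x /=; rewrite in_itv.
Qed.

Lemma lebesgue_tube_slab i c d M : 0 <= d -> 0 <= M ->
  L (tube i c d `&` slab i M) = (2 * M * (2 * d) ^+ n.-1)%:E.
Proof.
move=> d0 M0.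
pose a : Rn R n := \row_j (if j == i then - M else c 0 j - d).
pose b : Rn R n := \row_j (if j == i then M else c 0 j + d).
have -> : tube i c d `&` slab i M =
    [set x : BRn R n | forall j, a 0 j <= x 0 j <= b 0 j].
  apply/seteqP; split=> x /=.
    move=> [tx sx] j; rewrite !mxE; case: eqVneq => [->//|ji].
    by have := tx j ji; rewrite /= in_itv.
  move=> h; split; last by have := h i; rewrite !mxE eqxx.
  by move=> j ji; have := h j; rewrite !mxE (negbTE ji) /= in_itv.
rewrite lebL; last by move=> j; rewrite !mxE; case: ifP => _; lra.
rewrite (bigD1 i) //= !mxE eqxx; congr (_ * _)%:E; first by ring.
rewrite (eq_bigr (fun=> 2 * d)); last first.
  by move=> j /negbTE ji; rewrite !mxE ji; ring.
by rewrite prodr_const cardC1 card_ord.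
Qed.

(** Covers of F by sets of diameter d_k with small sum of d_k^s become covers by tubes whose cross
    sections have small total volume. C is the intersection over j of such unions of tubes, with
    total at most 2^(n-1)/(j+1). It ignores the i-th coordinate because each tube does. *)
Lemma hausdorff_null_cylinder i s (F : set (Rn R n)) :
  0 <= s -> s < n%:R - 1 -> hausdorff_measure s F = 0%E ->
  exists C : set (BRn R n), [/\ measurable C, F `<=` C, L C = 0%E &
    forall x, C (flatten_coord i x) <-> C x].
Proof.
move=> s0 sn hF0.
have cover (e : R) : 0 < e -> exists cd : nat -> Rn R n * R,
    [/\ forall k, 0 <= (cd k).2, F `<=` \bigcup_k tube i (cd k).1 (cd k).2 &
     (\sum_(k <oo) ((2 * (cd k).2) ^+ n.-1)%:E <= (2 ^+ n.-1 * e)%:E)%E].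
  move=> e0.
  (* The Hausdorff measure is a supremum over delta, so its vanishing already controls covers at the
     single scale delta = 1. *)
  have hd : (hausdorff_delta s 1 F <= 0)%E.
    by rewrite -hF0; apply: ereal_sup_ubound; exists 1 => //=.
  have [U [[FU U1] Ue]] : exists U : nat -> set (Rn R n),
      (F `<=` \bigcup_k U k /\ forall k, (diam (U k) <= 1%:E)%E) /\
      (\sum_(k <oo) diam_pow s (U k) < e%:E)%E.
    apply: contrapT => /forallNP h.
    suff : (e%:E <= 0)%E by rewrite lee_fin leNgt e0.
    apply: le_trans hd; apply: le_ereal_inf_tmp => _ [U UF <-].
    by rewrite leNgt; apply/negP => lt; apply: (h U).
  have /choice[cd hcd] := fun k => small_set_in_tube i sn s0 (U1 k).
  exists cd; split=> [k|x /FU[k _ Ukx]|]; first by have [] := hcd k.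
    by exists k => //; have [_ h _] := hcd k; exact: h.
  apply: (@le_trans _ _ (\sum_(k <oo) (2 ^+ n.-1)%:E * diam_pow s (U k))%E).
    apply: lee_nneseries => k _; last by have [] := hcd k.
    by have [d0 _ _] := hcd k; rewrite lee_fin exprn_ge0 // mulr_ge0.
  rewrite nneseriesZl; last first.
    by move=> k _; rewrite /diam_pow; case: pselect => [?|?]; rewrite lee_fin ?powR_ge0.
  by rewrite EFinM lee_pmul2l ?ltW // lte_fin exprn_gt0.
have /choice[cd hcd] := fun j : nat => cover j.+1%:R^-1 (ltac:(by rewrite invr_gt0)).
pose C := \bigcap_j \bigcup_k tube i (cd j k).1 (cd j k).2.
have mC : measurable C.
  by apply: bigcapT_measurable => j; apply: bigcupT_measurable => k; exact: measurable_tube.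
exists C; split => //; first by move=> x Fx j _; have [_ h _] := hcd j; exact: h.
  have LM (M : nat) : L (C `&` slab i M%:R) = 0%E.
    apply/eqP; rewrite eq_le measure_ge0 andbT; apply/lee_addgt0Pr => e e0.
    rewrite add0e.
    (* The left-hand side is the slab height 2M times the bound on the total cross section at level
       j. *)
    have [j je] : exists j : nat, 2 * M%:R * (2 ^+ n.-1 * j.+1%:R^-1) <= e.
      exists (Num.Def.trunc (2 * M%:R * 2 ^+ n.-1 / e)).
      rewrite mulrA ler_pdivrMr ?ltr0n // [leRHS]mulrC -ler_pdivrMr //.
      exact/ltW/truncnS_gt.
    apply: (@le_trans _ _ (\sum_(k <oo) L (tube i (cd j k).1 (cd j k).2 `&` slab i M%:R))%E).
      apply: measure_sigma_subadditive => [k||x [Cx Sx]].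
      - by apply: measurableI; [exact: measurable_tube|exact: measurable_slab].
      - by apply: measurableI => //; exact: measurable_slab.
      by have [k _ tx] := Cx j I; exists k.
    have [d0 _ sm] := hcd j.
    rewrite (eq_eseriesr (fun k _ => lebesgue_tube_slab i (cd j k).1 (d0 k) (ler0n R M))).
    under eq_eseriesr do rewrite EFinM.
    rewrite nneseriesZl; last first.
      by move=> k _; rewrite lee_fin exprn_ge0 // mulr_ge0.
    apply: (@le_trans _ _ ((2 * M%:R)%:E * (2 ^+ n.-1 * j.+1%:R^-1)%:E)%E).
      by rewrite lee_wpmul2l // lee_fin mulr_ge0.
    by rewrite -EFinM lee_fin.
  apply/eqP; rewrite eq_le measure_ge0 andbT.
  apply: (@le_trans _ _ (\sum_(M <oo) L (C `&` slab i M%:R))%E).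
    apply: measure_sigma_subadditive => [k|//|x Cx].
      by apply: measurableI => //; exact: measurable_slab.
    exists (Num.Def.trunc `|x 0 i|).+1 => //; split => //=.
    by rewrite /slab /= -ler_norml; exact/ltW/truncnS_gt.
  by rewrite eseries0.
move=> x; split=> Cx j _; have [k _ tx] := Cx j I; exists k => //.
  exact: (tube_flatten_coord i _ _ x).1 tx.
exact: (tube_flatten_coord i _ _ x).2 tx.
Qed.

End NullCylinder.

(** * Uniqueness for charges and integrals against signed measures *)

Section SignedIntegral.
Variables (R : realType) (n : nat).

Lemma sube_exchange (p q p' q' : \bar R) : p \is a fin_num -> q \is a fin_num ->
  p' \is a fin_num -> q' \is a fin_num ->
  (p' - q' = p - q -> p + q' = p' + q)%E.
Proof.
by move: p q p' q' => [p||] [q||] [p'||] [q'||] //= _ _ _ _ [] e; congr EFin; lra.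
Qed.

Lemma sube_exchangeV (p q p' q' : \bar R) : p \is a fin_num -> q \is a fin_num ->
  p' \is a fin_num -> q' \is a fin_num ->
  (p + q' = p' + q -> p = q + (p' - q'))%E.
Proof.
by move: p q p' q' => [p||] [q||] [p'||] [q'||] //= _ _ _ _ [] e; congr EFin; lra.
Qed.

(** Without positivity the argument is Dynkin's, run on the sets B for which the charges agree on
    the preimage of B: equality of the finite total masses handles complements, sigma-additivity
    handles disjoint unions. *)
Lemma charge_preimage_obox_eq (c1 c2 : {charge set (BRn R n) -> \bar R})
    (p : BRn R n -> BRn R n) : measurable_fun setT p ->
  c1 setT = c2 setT -> (forall a b, c1 (p @^-1` obox a b) = c2 (p @^-1` obox a b)) ->
  forall A, measurable A -> c1 (p @^-1` A) = c2 (p @^-1` A).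
Proof.
move=> mp cT cb A; rewrite borel_obox => sA.
have mpre B : measurable B -> measurable (p @^-1` B).
  by move=> mB; rewrite -[X in measurable X]setTI; exact: mp.
apply: (@dynkin_induction _ (BRn R n) _ (fun B => c1 (p @^-1` B) = c2 (p @^-1` B))
  (borel_obox R n) _ _ _ _ _ A sA) => //.
- exact: setI_closed_obox.
- by move=> _ [ab _ <-].
- move=> B mB cB.
  have e (c : {charge set (BRn R n) -> \bar R}) :
      c (p @^-1` (~` B)) = (c setT - c (p @^-1` B))%E.
    rewrite -(setUv (p @^-1` B)) -preimage_setC chargeU //; last first.
    - by rewrite preimage_setC setICr.
    - exact: (mpre _ (measurableC mB)).
    - exact: (mpre _ mB).
    by rewrite addeAC subee ?add0e // fin_num_measure //; exact: (mpre _ mB).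
  by rewrite !e cT cB.
- move=> F mF tF cF; rewrite preimage_bigcup.
  have mpF k : measurable (p @^-1` F k) by exact: (mpre _ (mF k)).
  have mU : measurable (\bigcup_k p @^-1` F k) by exact: bigcupT_measurable.
  have tpF : trivIset setT (fun k => p @^-1` F k).
    apply/trivIsetP => j k _ _ jk; rewrite -preimage_setI.
    by move/trivIsetP : tF => /(_ _ _ _ _ jk) ->//; rewrite preimage_set0.
  have := @charge_semi_sigma_additive _ _ _ c1 _ mpF tpF mU.
  have := @charge_semi_sigma_additive _ _ _ c2 _ mpF tpF mU.
  under eq_cvg do under eq_bigr do rewrite -cF.
  move=> h2 h1; exact: (cvg_unique _ h1 h2).
Qed.

Lemma bounded_integrable (P : {finite_measure set (BRn R n) -> \bar R})
    (A : set (BRn R n)) (h : BRn R n -> R) :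
  measurable A -> measurable_fun setT h -> (forall x, 0 <= h x <= 1) ->
  P.-integrable A (EFin \o h).
Proof.
move=> mA mh h01; apply: (@le_integrable _ _ _ _ _ _ _ (EFin \o cst 1)) => //.
- by apply/measurable_EFinP; exact: measurable_funTS.
- move=> x _ /=; rewrite lee_fin normr1.
  by have /andP[? ?] := h01 x; rewrite ger0_norm.
- exact: finite_measure_integrable_cst.
Qed.

(* The decomposition in [signed_integral] may depend on the integrand; here it
   is replaced by a fixed one. *)
Lemma signed_integral_eq (nu : {charge set (BRn R n) -> \bar R})
    (P N : {finite_measure set (BRn R n) -> \bar R}) (h : BRn R n -> R) (v : R) :
  (forall A, measurable A -> nu A = (P A - N A)%E) ->
  measurable_fun setT h -> (forall x, 0 <= h x <= 1) ->
  signed_integral nu h v ->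
  (\int[P]_x (h x)%:E = \int[N]_x (h x)%:E + v%:E)%E.
Proof.
move=> nuPN mh h01 [P' [N' [nuPN' vE]]].
have mh' : measurable_fun setT (EFin \o h) by exact/measurable_EFinP.
have h0 x : [set: BRn R n] x -> (0 <= (h x)%:E)%E.
  by move=> _; rewrite lee_fin; have /andP[] := h01 x.
have fin (Q : {finite_measure set (BRn R n) -> \bar R}) :
    (\int[Q]_x (h x)%:E)%E \is a fin_num.
  by apply: integrable_fin_num => //; exact: bounded_integrable.
(* From P - N = P' - N' the positive measures P + N' and P' + N coincide, so they give the same
   integral of h >= 0. *)
have e : (\int[P]_x (h x)%:E + \int[N']_x (h x)%:E =
          \int[P']_x (h x)%:E + \int[N]_x (h x)%:E)%E.
  rewrite -!ge0_integral_measure_add //.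
  apply: eq_measure_integral => A mA _.
  apply: (etrans (measure_addE P N' A)); apply: (etrans _ (esym (measure_addE P' N A))).
  have := nuPN A mA; rewrite nuPN' //.
  have Q (Q : {finite_measure set (BRn R n) -> \bar R}) : Q A \is a fin_num.
    exact: fin_num_measure.
  by move=> e; exact: (sube_exchange (Q P) (Q N) (Q P') (Q N') e).
rewrite -vE.
exact: (sube_exchangeV (fin P) (fin N) (fin P') (fin N') e).
Qed.

End SignedIntegral.

(** * Test functions that approximate u(x_i) on an open cylinder *)

Section SliceTest.
Variables (R : realType) (n : nat) (i : 'I_n).
Implicit Types (a b x : Rn R n) (u : R -> R).

Definition slice_test a b u (r : nat) : Rn R n -> R :=
  tensor (fun j => if j == i then u else bump (a 0 j) (b 0 j) r).

Definition ocyl a b : set (BRn R n) := cylinder i (fun j => `]a 0 j, b 0 j[%classic).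

Lemma measurable_ocyl a b : measurable (ocyl a b).
Proof. exact: measurable_cylinder. Qed.

Lemma slice_testE a b u r x : slice_test a b u r x =
  u (x 0 i) * \prod_(j | j != i) bump (a 0 j) (b 0 j) r (x 0 j).
Proof.
rewrite /slice_test /tensor (bigD1 i) //= eqxx; congr (_ * _).
by apply: eq_bigr => j /negbTE ->.
Qed.

Lemma slice_test_cvg a b u x :
  slice_test a b u r x @[r --> \oo] --> ((fun y => u (y 0 i)) \_ (ocyl a b)) x.
Proof.
pose l j := if j == i then u (x 0 i) else if a 0 j < x 0 j < b 0 j then 1 else 0 : R.
have -> : ((fun y : Rn R n => u (y 0 i)) \_ (ocyl a b)) x = \prod_j l j.
  rewrite patchE; case: ifPn => [/set_mem Qx|/negP Qx].
    rewrite (bigD1 i) //= {1}/l eqxx big1 ?mulr1 // => j ji.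
    by have := Qx j ji; rewrite /l (negbTE ji) /= in_itv /= => ->.
  have [j /not_implyP[ji jx]] : exists j, ~ (j != i -> `]a 0 j, b 0 j[%classic (x 0 j)).
    by apply/existsNP => h; apply: Qx; exact/mem_set.
  rewrite (bigD1 j) //= /l (negbTE ji) ifF ?mul0r //.
  by apply/negP => h; apply: jx; rewrite /= in_itv.
apply: cvg_bigprod => j; rewrite /l; case: eqVneq => [->|ji]; first exact: cvg_cst.
exact: bump_cvg.
Qed.

Lemma slice_weight01 a b r x :
  0 <= \prod_(j | j != i) bump (a 0 j) (b 0 j) r (x 0 j) <= 1.
Proof.
apply: (big_ind (fun q => 0 <= q <= 1)) => [|y z /andP[? ?] /andP[? ?]|j _].
- by rewrite ler01 lexx.
- by rewrite mulr_ge0 ?mulr_ile1.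
- by rewrite bump_ge0 bump_le1.
Qed.

Lemma slice_test_le a b u r x : `|slice_test a b u r x| <= `|u (x 0 i)|.
Proof.
have /andP[p0 p1] := slice_weight01 a b r x.
by rewrite slice_testE normrM ler_piMr // ger0_norm.
Qed.

(** The bumps are not differentiated, so the result is again a [slice_test] and keeps the bound of
    [slice_test_le], uniform in r. *)
Lemma iter_partial_slice_test a b u r m : smooth1 u ->
  iter_partial (nseq m i) (slice_test a b u r) = slice_test a b (derive1n m u) r.
Proof.
move=> su; rewrite iter_partial_tensor; last first.
  by move=> j; case: ifP => _; [exact: su|exact: bump_smooth].
congr tensor; apply/funext => j; rewrite count_nseq /= eq_sym.
by case: eqVneq => _; rewrite ?mul1n ?mul0n.
Qed.

Lemma slice_test_out a b c d u r x :
  (forall t, ~~ (c <= t <= d) -> u t = 0) ->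
  ~ cbox (\row_j (if j == i then c else a 0 j)) (\row_j (if j == i then d else b 0 j)) x ->
  slice_test a b u r x = 0.
Proof.
move=> u0; apply: tensor_out => j t; rewrite !mxE; case: ifP => _; first exact: u0.
by move=> h; apply: bump_out; apply: contra h => /andP[/ltW-> /ltW->].
Qed.

Lemma slice_test_test_function a b c d u r : smooth1 u ->
  (forall t, ~~ (c <= t <= d) -> u t = 0) ->
  test_function (slice_test a b u r).
Proof.
move=> su u0.
apply: (@tensor_test_function _ _ (\row_j (if j == i then c else a 0 j))
  (\row_j (if j == i then d else b 0 j))) => j.
  by case: ifP => _; [exact: su|exact: bump_smooth].
move=> t; rewrite !mxE; case: ifP => _; first exact: u0.
by move=> h; apply: bump_out; apply: contra h => /andP[/ltW-> /ltW->].
Qed.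

Lemma measurable_slice_test a b u r : continuous u ->
  measurable_fun setT (slice_test a b u r : BRn R n -> R).
Proof.
move=> cu; apply: continuous_measurable_Rn; apply: tensor_continuous => j.
by case: ifP => _; [exact: cu|exact: bump_continuous].
Qed.

Lemma measurable_coord_comp u : continuous u ->
  measurable_fun setT (fun x : BRn R n => u (x 0 i)).
Proof.
move=> cu; apply: (measurableT_comp (f := u)); last exact: measurable_coord.
exact: continuous_measurable_fun.
Qed.

End SliceTest.

(** * The integral identity on cylinders *)

Section CylinderIdentity.
Variables (R : realType) (n : nat) (L : {measure set (BRn R n) -> \bar R}).
Variables (f : BRn R n -> R) (i : 'I_n) (m : nat).
Variables (nu : {charge set (BRn R n) -> \bar R}).
Variables (P N : {finite_measure set (BRn R n) -> \bar R}).
Hypothesis locf : loc_integrable L f.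
Hypothesis nuPN : forall A, measurable A -> nu A = (P A - N A)%E.
Hypothesis nuE : forall phi : Rn R n -> R, test_function phi ->
  signed_integral nu phi
    (fine (\int[L]_x ((f x * ((-1) ^+ m * iter_partial (nseq m i) phi x))%:E))).
Variables (u : R -> R) (c d : R).
Hypothesis smooth_u : smooth1 u.
Hypothesis u01 : forall t, 0 <= u t <= 1.
Hypothesis u_out : forall t, ~~ (c < t < d) -> u t = 0.

Let G (x : BRn R n) : R := f x * ((-1) ^+ m * derive1n m u (x 0 i)).

Let cu : continuous u.
Proof.
move=> t; apply: differentiable_continuous; apply/derivable1_diffP.
exact: (@smooth_u 0%N).
Qed.

Let mf : measurable_fun setT f. Proof. by case: locf. Qed.

Let integrable_u_coord (Q : {finite_measure set (BRn R n) -> \bar R})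
    (A : set (BRn R n)) : measurable A ->
  Q.-integrable A (fun x => (u (x 0 i))%:E).
Proof.
move=> mA; apply: (@bounded_integrable _ _ Q A (fun x => u (x 0 i))) => //.
exact: measurable_coord_comp.
Qed.

Let cvg_fin (Q : {finite_measure set (BRn R n) -> \bar R}) a b :
  (\int[Q]_x (slice_test i a b u r x)%:E)%E @[r --> \oo] -->
  (\int[Q]_(x in ocyl i a b) (u (x 0 i))%:E)%E.
Proof.
rewrite [X in _ --> X]integral_mkcond.
apply: (@dominated_cvg _ _ _ _ _ _ _ _ (EFin \o cst 1)) => //.
- by move=> r; apply/measurable_EFinP; exact: measurable_slice_test.
- move=> x _; rewrite [X in _ --> X](_ : _ =
    (((fun y => u (y 0 i)) \_ (ocyl i a b)) x)%:E); last by rewrite !patchE; case: ifP.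
  by apply: cvg_EFin; [exact: nearW|exact: slice_test_cvg].
- exact: finite_measure_integrable_cst.
- move=> r x _ /=; rewrite lee_fin (le_trans (slice_test_le _ _ _ _ _ _)) //.
  by have /andP[? ?] := u01 (x 0 i); rewrite ger0_norm.
Qed.

(** Dominated convergence in the identity for [slice_test], with majorant 1 for the finite measures
    P and N. For [L], the m-th derivative of u vanishes off [c, d], so everything lives on a compact
    box where f is integrable. The integrability of [G] is recorded because it is what makes its
    integral a charge. *)
Lemma cylinder_identity a b :
  L.-integrable (ocyl i a b) (EFin \o G) /\
  (\int[P]_(x in ocyl i a b) (u (x 0 i))%:E =
   \int[N]_(x in ocyl i a b) (u (x 0 i))%:E + \int[L]_(x in ocyl i a b) (G x)%:E)%E.
Proof.
have [M M0 uM] := @derive1n_bounded _ c d u m smooth_u u_out.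
have w_out t : ~~ (c <= t <= d) -> derive1n m u t = 0.
  exact: (@derive1n_out _ _ _ _ u_out m t).
have u_out' t : ~~ (c <= t <= d) -> u t = 0 by exact: (@derive1n_out _ _ _ _ u_out 0%N t).
have cw : continuous (derive1n m u) by exact: smooth1_continuous.
pose K : set (Rn R n) := cbox (\row_j (if j == i then c else a 0 j))
                 (\row_j (if j == i then d else b 0 j)).
have mK : measurable (K : set (BRn R n)) by exact: measurable_cbox.
(* The integrable majorant for the passage to the limit in the f-integrals. *)
pose g : BRn R n -> \bar R := (fun x => (M * `|f x|)%:E) \_ K.
have intg : L.-integrable setT g.
  apply/(integrable_mkcond _ mK); under eq_fun do rewrite EFinM.
  apply: integrableZl => //.
  have [_ /(_ K (@compact_cbox _ _ _ _))] := locf.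
  exact: integrable_abse.
pose F r (x : BRn R n) : R := f x * ((-1) ^+ m * slice_test i a b (derive1n m u) r x).
have mF r : measurable_fun setT (EFin \o F r).
  apply/measurable_EFinP; apply: (@measurable_funM _ _ _ _ f) => //.
  apply: (@measurable_funM _ _ _ _ (cst ((-1) ^+ m))) => //.
  exact: (@measurable_slice_test _ _ i a b _ r cw).
have mGQ : measurable_fun setT ((EFin \o G) \_ (ocyl i a b)).
  apply: (measurable_restrictT _ (@measurable_ocyl _ _ i a b)).1.
  apply: measurable_funTS; apply/measurable_EFinP.
  apply: (@measurable_funM _ _ _ _ f) => //.
  apply: (@measurable_funM _ _ _ _ (cst ((-1) ^+ m))) => //.
  exact: (@measurable_coord_comp _ _ i _ cw).
have Fg r x : (`|(F r x)%:E| <= g x)%E.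
  rewrite /g patchE; case: ifPn => [_|/negP xK].
    rewrite lee_fin /F !normrM normrX normrN1 expr1n mul1r mulrC ler_wpM2r //.
    exact: le_trans (slice_test_le _ _ _ _ _ _) (uM _).
  rewrite /F (@slice_test_out _ _ i a b c d _ r x w_out) ?mulr0 ?abse0 ?lexx //.
  by move=> h; apply: xK; exact/mem_set.
have FG x : (F r x)%:E @[r --> \oo] --> ((EFin \o G) \_ (ocyl i a b)) x.
  rewrite [X in _ --> X](_ : _ = (f x * ((-1) ^+ m *
    ((fun y : Rn R n => derive1n m u (y 0 i)) \_ (ocyl i a b)) x))%:E); last first.
    by rewrite !patchE; case: ifP => // _; rewrite !mulr0.
  apply: cvg_EFin; first exact: nearW.
  by apply: cvgMr; apply: cvgMr; exact: slice_test_cvg.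
have [intG _ cvgL] := @dominated_convergence _ _ _ L setT measurableT
  (fun r => EFin \o F r) _ g mF mGQ (aeW _ (fun x _ => FG x)) intg
  (aeW _ (fun x r _ => Fg r x)).
split; first exact/(integrable_mkcond _ (@measurable_ocyl _ _ i a b)).
have step r : (\int[P]_x (slice_test i a b u r x)%:E =
    \int[N]_x (slice_test i a b u r x)%:E + \int[L]_x (F r x)%:E)%E.
  have tf := @slice_test_test_function _ _ i a b c d _ r smooth_u u_out'.
  have := nuE tf; rewrite iter_partial_slice_test // -/(F r) => si.
  rewrite (signed_integral_eq nuPN _ _ si) //; last 2 first.
  - exact: measurable_slice_test.
  - move=> x; rewrite slice_testE; have /andP[ux0 ux1] := u01 (x 0 i).
    have /andP[p0 p1] := slice_weight01 i a b r x.
    by rewrite mulr_ge0 ?mulr_ile1.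
  (* [fine] loses nothing here: the majorant g makes the integral of [F r] finite. *)
  congr (_ + _)%E; rewrite fineK //.
  apply: integrable_fin_num => //.
  apply: (@le_integrable _ _ _ L setT measurableT (EFin \o F r) g (mF r)) => // x _.
  by rewrite (le_trans (Fg r x)) // lee_abs.
have cvgP : (\int[P]_x (slice_test i a b u r x)%:E)%E @[r --> \oo] -->
    (\int[N]_(x in ocyl i a b) (u (x 0 i))%:E + \int[L]_(x in ocyl i a b) (G x)%:E)%E.
  under eq_cvg do rewrite step.
  apply: cvgeD; last by move: cvgL; rewrite -integral_mkcond.
    rewrite fin_num_adde_defr // integrable_fin_num //; first exact: (@measurable_ocyl _ _ i a b).
    by apply: integrable_u_coord; exact: (@measurable_ocyl _ _ i a b).
  exact: cvg_fin.
have cvgP' := @cvg_fin P a b.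
by apply: (cvg_unique _ cvgP' cvgP).
Qed.

(** For fixed a and b both sides are charges in the set, induced by integrable functions cut off to
    [ocyl i a b]. They agree on preimages of boxes, which meet [ocyl i a b] in an open cylinder or
    not at all. *)
Lemma preimage_flatten_identity a b (A : set (BRn R n)) : measurable A ->
  (\int[P]_(x in flatten_coord i @^-1` A `&` ocyl i a b) (u (x 0 i))%:E =
   \int[N]_(x in flatten_coord i @^-1` A `&` ocyl i a b) (u (x 0 i))%:E +
   \int[L]_(x in flatten_coord i @^-1` A `&` ocyl i a b) (G x)%:E)%E.
Proof.
have mQ := @measurable_ocyl _ _ i a b.
have iP : P.-integrable setT ((fun x => (u (x 0 i))%:E) \_ (ocyl i a b)).
  by apply/(integrable_mkcond _ mQ); exact: integrable_u_coord.
have iN : N.-integrable setT ((fun x => (u (x 0 i))%:E) \_ (ocyl i a b)).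
  by apply/(integrable_mkcond _ mQ); exact: integrable_u_coord.
have iL : L.-integrable setT ((EFin \o G) \_ (ocyl i a b)).
  by apply/(integrable_mkcond _ mQ); have [] := cylinder_identity a b.
rewrite !integral_mkcondr; move: A.
apply: (@charge_preimage_obox_eq _ _ (induced_charge iP)
  (cadd (induced_charge iN) (induced_charge iL)) _ (@measurable_flatten_coord _ _ i)).
  (* The total masses agree by the identity on [ocyl i a b] itself. *)
  rewrite /= /cadd /= /induced_charge -!integral_mkcond.
  by have [] := cylinder_identity a b.
move=> a' b'; rewrite /= /cadd /= /induced_charge -!integral_mkcondr.
have [h|h] := boolP (a' 0 i < 0 < b' 0 i).
  have -> : flatten_coord i @^-1` obox a' b' `&` ocyl i a b =
      ocyl i (\row_j Num.max (a' 0 j) (a 0 j)) (\row_j Num.min (b' 0 j) (b 0 j)).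
    apply/seteqP; split => x /=.
      move=> [h1 h2] j ji; have := h1 j; have := h2 j ji.
      rewrite !mxE (negbTE ji) /= !in_itv /= gt_max lt_min.
      by move=> /andP[-> ->] /andP[-> ->].
    move=> hx; split=> j; last first.
      move=> ji; have := hx j ji; rewrite !mxE /= !in_itv /= gt_max lt_min.
      by move=> /andP[/andP[_ ->] /andP[_ ->]].
    rewrite mxE; case: (eqVneq j i) => [->//|ji].
    have := hx j ji; rewrite !mxE /= !in_itv /= gt_max lt_min.
    by move=> /andP[/andP[-> _] /andP[-> _]].
  by have [] := cylinder_identity (\row_j Num.max (a' 0 j) (a 0 j))
    (\row_j Num.min (b' 0 j) (b 0 j)).
rewrite [X in X `&` _](_ : _ = set0) ?set0I ?integral_set0 ?adde0 //.
apply/seteqP; split=> // x /= /(_ i).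
by rewrite mxE eqxx (negbTE h).
Qed.

End CylinderIdentity.

Lemma bump_integral_cvg (R : realType) (n : nat) (i : 'I_n)
    (Q : {finite_measure set (BRn R n) -> \bar R}) (D : set (BRn R n)) (s t : R) :
  measurable D ->
  (\int[Q]_(x in D) (bump s t r (x 0 i))%:E)%E @[r --> \oo] -->
  Q (D `&` [set x | s < x 0 i < t]).
Proof.
move=> mD.
have mS : measurable [set x : BRn R n | s < x 0 i < t].
  rewrite [X in measurable X](_ : _ =
    setT `&` (fun x : BRn R n => x 0 i) @^-1` `]s, t[%classic).
    exact: measurable_coord.
  by rewrite setTI; apply/seteqP; split=> x /=; rewrite in_itv.
rewrite setIC -integral_indic //.
apply: (@dominated_cvg _ _ _ _ _ mD _ _ (EFin \o cst 1)) => //.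
- move=> r; apply: measurable_funTS; apply/measurable_EFinP.
  exact: (@measurable_coord_comp _ _ i _ (@bump_continuous _ s t r)).
- move=> x _; apply: cvg_EFin; first exact: nearW.
  rewrite indicE mem_setE /=.
  rewrite [X in _ --> X](_ : _ = if s < x 0 i < t then 1 else 0).
    exact: bump_cvg.
  by rewrite unfold_in /=; case: ifP.
- exact: finite_measure_integrable_cst.
- move=> r x _; rewrite /= lee_fin ger0_norm ?bump_ge0 //; exact: bump_le1.
Qed.

(** * Vanishing on null cylinders and on Hausdorff null sets *)

Section NullSets.
Variables (R : realType) (n : nat) (L : {measure set (BRn R n) -> \bar R}).
Variables (f : BRn R n -> R) (i : 'I_n) (m : nat).
Variable (nu : {charge set (BRn R n) -> \bar R}).
Hypothesis locf : loc_integrable L f.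
Hypothesis nuE : forall phi : Rn R n -> R, test_function phi ->
  signed_integral nu phi
    (fine (\int[L]_x ((f x * ((-1) ^+ m * iter_partial (nseq m i) phi x))%:E))).

(** For each bump in x_i the [L]-integral over the null set is 0, so P and N give the bump the same
    integral. Letting r grow yields P = N on every box intersected with C, and finite measures that
    agree on boxes are equal. *)
Lemma charge_null_cylinder (C : set (BRn R n)) : measurable C -> L C = 0%E ->
  (forall x, C (flatten_coord i x) <-> C x) ->
  forall A, measurable A -> A `<=` C -> nu A = 0%E.
Proof.
move=> mC LC0 Cflat A mA AC.
(* Any one test function supplies a decomposition of nu, since [signed_integral] contains one. *)
have [P [N [nuPN _]]] : exists P N : {finite_measure set (BRn R n) -> \bar R},
    (forall A, measurable A -> nu A = (P A - N A)%E) /\ True.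
  have tf : test_function (tensor (fun=> bump 0 1 0) : Rn R n -> R).
    apply: (@tensor_test_function _ _ (const_mx 0) (const_mx 1)) => j.
      exact: bump_smooth.
    move=> t; rewrite !mxE => h; apply: bump_out.
    by apply: contra h => /andP[/ltW-> /ltW->].
  by have [P [N [h _]]] := nuE tf; exists P, N.
have preC : flatten_coord i @^-1` C = C by apply/seteqP; split=> x /Cflat.
have PN_obox a b : P (obox a b `&` C) = N (obox a b `&` C).
  have mD : measurable (C `&` ocyl i a b).
    by apply: measurableI => //; exact: (@measurable_ocyl _ _ i a b).
  have -> : obox a b `&` C = (C `&` ocyl i a b) `&` [set x | a 0 i < x 0 i < b 0 i].
    apply/seteqP; split=> [x [xab Cx]|x [[Cx xab] xi]].
      by split; [split=> // j _; rewrite /= in_itv /=; exact: xab|exact: xab].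
    split=> // j; have [->//|ji] := eqVneq j i.
    by have := xab j ji; rewrite /= in_itv.
  have cP := @bump_integral_cvg R n i P _ (a 0 i) (b 0 i) mD.
  have cN := @bump_integral_cvg R n i N _ (a 0 i) (b 0 i) mD.
  suff e r : (\int[P]_(x in C `&` ocyl i a b) (bump (a 0 i) (b 0 i) r (x 0 i))%:E =
      \int[N]_(x in C `&` ocyl i a b) (bump (a 0 i) (b 0 i) r (x 0 i))%:E)%E.
    have cN' : (\int[P]_(x in C `&` ocyl i a b) (bump (a 0 i) (b 0 i) r (x 0 i))%:E)%E
        @[r --> \oo] --> N ((C `&` ocyl i a b) `&` [set x | a 0 i < x 0 i < b 0 i]).
      by under eq_cvg do rewrite e.
    by apply: (cvg_unique _ cP cN').
  have u01 t : 0 <= bump (a 0 i) (b 0 i) r t <= 1 by rewrite bump_ge0 bump_le1.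
  have su := @bump_smooth _ (a 0 i) (b 0 i) r.
  have := preimage_flatten_identity locf nuPN nuE su u01 (@bump_out _ (a 0 i) (b 0 i) r) a b mC.
  rewrite preC => ->.
  pose G (x : BRn R n) : R :=
    f x * ((-1) ^+ m * derive1n m (bump (a 0 i) (b 0 i) r) (x 0 i)).
  have mG : measurable_fun (C `&` ocyl i a b) (EFin \o G).
    apply: measurable_funTS; apply/measurable_EFinP.
    apply: (@measurable_funM _ _ _ _ f); first by case: locf.
    apply: (@measurable_funM _ _ _ _ (cst ((-1) ^+ m))) => //.
    apply: (@measurable_coord_comp _ _ i (derive1n m _)).
    exact: smooth1_continuous.
  have LD0 : L (C `&` ocyl i a b) = 0%E.
    apply/eqP; rewrite eq_le measure_ge0 andbT -LC0.
    by apply: le_measure; rewrite ?inE //; exact: subIsetl.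
  by rewrite (null_set_integral mD mG LD0) adde0.
have PN : mrestr P mC A = mrestr N mC A.
  apply: (@finite_measure_obox_eq _ _ (mrestr P mC) (mrestr N mC)) => //.
  by rewrite /mrestr /= -ge0_fin_numE // fin_num_measure // setTI.
move: PN; rewrite /mrestr (setIidl AC) nuPN // => ->.
by rewrite subee // fin_num_measure.
Qed.

Lemma charge_hausdorff_null s (F : set (BRn R n)) : is_lebesgue L ->
  0 <= s -> s < n%:R - 1 -> measurable F ->
  hausdorff_measure s (F : set (Rn R n)) = 0%E -> nu F = 0%E.
Proof.
move=> lebL s0 sn mF F0.
have [C [mC FC LC Cflat]] := hausdorff_null_cylinder lebL i s0 sn F0.
exact: (@charge_null_cylinder C).
Qed.

End NullSets.

Theorem theorem3 (R : realType) (n : nat) (L : {measure set (BRn R n) -> \bar R})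
  (m : 'I_n -> nat) (fr fi : BRn R n -> R)
  (lr li : 'I_n -> {charge set (BRn R n) -> \bar R}) :
  (0 < n)%N ->
  is_lebesgue L ->
  loc_integrable L fr -> loc_integrable L fi ->
  (forall i : 'I_n, distr_deriv_is_measure L fr fi i (m i) (lr i) (li i)) ->
  ((n%:R - 1 : R)%:E <= vmeasure_dim lr li)%E.
Proof.
move=> _ lebL locr loci D.
apply: le_ereal_inf_tmp => _ [alpha [F [mF [[k lF] dimF]]] <-].
rewrite leNgt; apply/negP => lt_alpha.
(* Since dim F is an infimum below n - 1, some admissible exponent lies below n - 1 as well. *)
have [s [s0 F0 sn]] : exists s, [/\ 0 <= s, hausdorff_measure s (F : set (Rn R n)) = 0%E &
    s < n%:R - 1].
  apply: contrapT => h; move: (le_lt_trans dimF lt_alpha); apply/negP.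
  rewrite -leNgt; apply: le_ereal_inf_tmp => _ [s [s0 F0] <-].
  by rewrite lee_fin leNgt; apply/negP => sn; apply: h; exists s.
(* The index k of the component assumed nonzero on F serves as the direction of the cylinder. *)
have lr0 := charge_hausdorff_null locr (fun phi tf => (D k phi tf).1) lebL s0 sn mF F0.
have li0 := charge_hausdorff_null loci (fun phi tf => (D k phi tf).2) lebL s0 sn mF F0.
by case: lF; rewrite ?lr0 ?li0 eqxx.
Qed.
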